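(* For every positive integer $n$, both polynomials $R_n^{B,+}(t)$ and $R_n^{B,-}(t)$ are divisible by $(1+t)^m$, where $m=\lfloor (n-1)/2\rfloor$.
   Context: $\mathfrak{B}_n$ is the group of signed permutations in window notation $\pi=\pi_1\cdots\pi_n$ ($\pi_i\in\{\pm1,\dots,\pm n\}$, $\{|\pi_i|\}=[n]$), with $\mathrm{inv}_B(\pi)=|\{i<j:\pi_i>\pi_j\}|+|\{i<j:-\pi_i>\pi_j\}|+|\{i:\pi_i<0\}|$. Set $\pi_0=0$; $\mathrm{pk}_B(\pi)$ is the number of $i\in\{1,\dots,n-1\}$ with $\pi_{i-1}<\pi_i>\pi_{i+1}$, $\mathrm{val}_B(\pi)$ the number of $i\in\{1,\dots,n-1\}$ with $\pi_{i-1}>\pi_i<\pi_{i+1}$, and $\mathrm{altruns}_B(\pi)=\mathrm{pk}_B(\pi)+\mathrm{val}_B(\pi)+1$. Let $\mathfrak{B}_n^+$ be the set of $\pi$ with $\mathrm{inv}_B(\pi)$ even and $\mathfrak{B}_n^-=\mathfrak{B}_n\setminus\mathfrak{B}_n^+$. Define $R_n^{B,\pm}(t)=\sum_{\pi\in\mathfrak{B}_n^{\pm}}t^{\mathrm{altruns}_B(\pi)}$. *)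

(* Defs.v *)
From HB Require Import structures.
From mathcomp Require Import all_boot all_order all_fingroup all_algebra.

Set Implicit Arguments.
Unset Strict Implicit.
Unset Printing Implicit Defensive.

Import Order.TTheory GRing.Theory Num.Theory.
Local Open Scope ring_scope.

(* A signed permutation is encoded by the permutation i |-> |pi_i| of [n] and
   the set of positions carrying a minus sign, both shifted to start at 0.
   [window_inj] and [windowP] show that this is the same data as a window
   pi_1 ... pi_n of integers with { |pi_i| } = [n]. *)
Definition signed_perm (n : nat) : finType := ('S_n * {set 'I_n})%type.

(* [window w i] is pi_(i+1). *)
Definition window (n : nat) (w : signed_perm n) (i : 'I_n) : int :=
  if i \in w.2 then - (w.1 i).+1%:Z else (w.1 i).+1%:Z.

Lemma abs_window n (w : signed_perm n) i : `|window w i|%N = (w.1 i).+1.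
Proof. by rewrite /window; case: ifP => _ //; rewrite abszN. Qed.

Lemma window_inj n (w w' : signed_perm n) : window w =1 window w' -> w = w'.
Proof.
move=> e; have e1 : w.1 = w'.1.
  apply/permP => i; apply/val_inj/succn_inj.
  by rewrite -!abs_window e.
have e2 : w.2 = w'.2.
  apply/setP => i; move: (e i); rewrite /window e1.
  by case: (i \in w.2); case: (i \in w'.2).
by case: w w' e1 e2 {e} => [s N] [s' N'] /= -> ->.
Qed.

Lemma windowP n (f : 'I_n -> int) :
  (exists w : signed_perm n, window w =1 f) <->
  (forall k : nat, (exists i, `|f i|%N = k) <-> (1 <= k <= n)%N).
Proof.
split=> [[w e] k | H].
  split=> [[i <-]|/andP[k0 kn]]; first by rewrite -e abs_window ltn_ord.
  have kn' : (k.-1 < n)%N by rewrite prednK.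
  exists ((w.1)^-1%g (Ordinal kn')).
  by rewrite -e abs_window permKV prednK.
have H1 i : (1 <= `|f i| <= n)%N by apply/H; exists i.
have lt i : (`|f i|.-1 < n)%N by case/andP: (H1 i) => h ?; rewrite prednK.
pose g (i : 'I_n) : 'I_n := Ordinal (lt i).
have gsurj (k : 'I_n) : exists i, g i == k.
  have [|i ei] := (H k.+1).2; first by rewrite ltn_ord.
  by exists i; apply/eqP/val_inj; rewrite /= ei.
have gK : cancel (fun k => xchoose (gsurj k)) g.
  by move=> k; apply/eqP/(xchooseP (gsurj k)).
have ginj : injective g.
  exact: bij_inj (bij_can_bij (injF_bij (can_inj gK)) gK).
exists (perm ginj, [set i | f i < 0]) => i.
rewrite /window inE permE /= prednK; last by case/andP: (H1 i).
case: ltrP => h; last by rewrite gez0_abs.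
by rewrite ltz0_abs // opprK.
Qed.

(* [letter w i] is pi_i in the usual indexing, with the convention pi_0 = 0. *)
Definition letter (n : nat) (w : signed_perm n) (i : nat) : int :=
  nth 0 (0 :: [seq window w j | j : 'I_n]) i.

Lemma letterS n (w : signed_perm n) (i : 'I_n) : letter w i.+1 = window w i.
Proof.
by rewrite /letter /= (nth_map i) ?size_enum_ord // nth_ord_enum.
Qed.

Definition inv_B (n : nat) (w : signed_perm n) : nat :=
  (#|[set ij : 'I_n * 'I_n |
        (ij.1 < ij.2) && (window w ij.1 > window w ij.2)%R]|
   + #|[set ij : 'I_n * 'I_n |
        (ij.1 < ij.2) && (- window w ij.1 > window w ij.2)%R]|
   + #|[set i : 'I_n | (window w i < 0)%R]|)%N.

(* The positions 1, ..., n - 1 are the nonzero elements of 'I_n. *)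
Definition pk_B (n : nat) (w : signed_perm n) : nat :=
  #|[set i : 'I_n | [&& (0 < i)%N,
       letter w i.-1 < letter w i & letter w i > letter w i.+1]]|.

Definition val_B (n : nat) (w : signed_perm n) : nat :=
  #|[set i : 'I_n | [&& (0 < i)%N,
       letter w i.-1 > letter w i & letter w i < letter w i.+1]]|.

Definition altruns_B (n : nat) (w : signed_perm n) : nat :=
  (pk_B w + val_B w + 1)%N.

Definition Bplus (n : nat) : {set signed_perm n} :=
  [set w | ~~ odd (inv_B w)].

Definition Bminus (n : nat) : {set signed_perm n} := ~: Bplus n.

Definition R_Bplus (n : nat) : {poly int} :=
  \sum_(w in Bplus n) 'X^(altruns_B w).

Definition R_Bminus (n : nat) : {poly int} :=
  \sum_(w in Bminus n) 'X^(altruns_B w).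

(* Divisibility in Z[t] itself: polydiv's [%|] on {poly int} is
   pseudo-divisibility, which ignores nonzero integer factors. *)
Definition divides_in_Zt (p q : {poly int}) : Prop :=
  exists r : {poly int}, q = p * r.

(* Main.v *)
(* For u = 1 and u = -1 consider the sum of u^inv_B(pi) t^altruns_B(pi) over the
   signed permutations; the two polynomials of the theorem are half the sum and
   half the difference of these, and (1+t)^m is monic, so it suffices to divide
   the two u-sums. The parity of inv_B is that of the inversions of |pi| plus
   the number of minus signs, so |pi| can be fixed. Whether the step from
   pi_(k-1) to pi_k is an ascent depends only on the sign of the larger of the
   two in absolute value. Summing over the signs, a position at which |pi| keeps
   its direction contributes 1 + t if u = 1 and alternately 1 + t and 1 - t if
   u = -1; a peak of |pi| contributes t; a valley contributes 2(1 + t) if u = 1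
   and annihilates the sum if u = -1. *)
Require Import Defs.
From mathcomp Require Import all_boot all_order all_fingroup all_algebra.
From mathcomp Require Import ring zify.

Set Implicit Arguments.
Unset Strict Implicit.

Import Order.TTheory GRing.Theory Num.Theory.
Local Open Scope ring_scope.

(** * Sign sums over words with prescribed absolute values *)

Definition signed_int (e : bool) (x : nat) : int := if e then - x%:Z else x%:Z.

Definition signed_word (xs : seq nat) (es : seq bool) : seq int :=
  [seq signed_int p.2 p.1 | p <- zip xs es].

(* [c] records whether the step that led to the letter [y] was an ascent. *)
Fixpoint turns (c : bool) (y : int) (ys : seq int) : nat :=
  if ys is y' :: ys' then ((c != (y < y')%R) + turns (y < y')%R y' ys')%N else 0%N.

(* Summing over the signs of [xs], given the sign [e] of the letter [x] before
   them and the direction [c] of the step into [x]. *)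
Definition run_sum (u : {poly int}) (xs : seq nat) (x : nat) (e c : bool) :
    {poly int} :=
  \sum_(es : (size xs).-tuple bool)
    u ^+ count id es * 'X^(turns c (signed_int e x) (signed_word xs es)).

Lemma signed_int_lt (e e' : bool) (x x' : nat) : x != x' ->
  (signed_int e x < signed_int e' x') = if (x < x')%N then ~~ e' else e.
Proof. by rewrite /signed_int; case: e; case: e'; case: ltnP; lia. Qed.

Lemma big_tuple_cons (R : nmodType) (T : finType) n (F : seq T -> R) :
  \sum_(t : n.+1.-tuple T) F t = \sum_(a : T) \sum_(t : n.-tuple T) F (a :: t).
Proof.
rewrite pair_big /= (reindex (fun p : T * n.-tuple T => [tuple of p.1 :: p.2])).
  by [].
exists (fun t : n.+1.-tuple T => (thead t, [tuple of behead t])) => [[a t] _|t _].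
  by congr (_, _); apply: val_inj.
by rewrite /= -tuple_eta.
Qed.

Lemma run_sum_nil u x e c : run_sum u [::] x e c = 1.
Proof.
rewrite /run_sum /= (big_pred1 [tuple]) /= ?mulr1 // => t.
by apply/esym/eqP/val_inj; case: t => -[].
Qed.

Lemma run_sum_cons u xs x x' e c : x != x' ->
  run_sum u (x' :: xs) x e c =
  \sum_(e' : bool) u ^+ e' *
    ('X^(c != if (x < x')%N then ~~ e' else e) *
      run_sum u xs x' e' (if (x < x')%N then ~~ e' else e)).
Proof.
move=> nx; rewrite /run_sum /=.
rewrite (big_tuple_cons _ (fun es => u ^+ count id es *
  'X^(turns c (signed_int e x) (signed_word (x' :: xs) es)))).
apply: eq_bigr => e' _; rewrite !mulr_sumr; apply: eq_bigr => es _ /=.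
by rewrite signed_int_lt // !exprD; ring.
Qed.

(** The sign of the larger letter [x'] decides the direction of the step, so [e] drops out. *)
Lemma run_sum_asc u xs x x' e c : (x < x')%N ->
  run_sum u (x' :: xs) x e c =
  'X^(~~ c) * run_sum u xs x' false true + u * 'X^c * run_sum u xs x' true false.
Proof.
move=> lt; rewrite run_sum_cons ?neq_ltn ?lt // big_bool /=.
by case: c => /=; ring.
Qed.

Lemma run_sum_desc u xs x x' e c : (x' < x)%N ->
  run_sum u (x' :: xs) x e c =
  'X^(c != e) * (run_sum u xs x' false e + u * run_sum u xs x' true e).
Proof.
move=> lt; rewrite run_sum_cons ?neq_ltn ?lt ?orbT // big_bool /=.
by rewrite ltnNge (ltnW lt) /=; ring.
Qed.

Notation neq_path := (path [rel x y : nat | x != y]).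

Section UnipotentWeight.

Variable u : {poly int}.
Hypothesis u2 : u * u = 1.

Let uX_unip k : u ^+ k * u ^+ k = 1.
Proof. by rewrite -exprMn u2 expr1n. Qed.

(** Flipping all signs reverses every comparison, hence keeps the turns, and changes [k] minus signs
    among [xs] into [size xs - k]; [u] is its own inverse. *)
Lemma run_sum_neg xs x e c : neq_path x xs ->
  run_sum u xs x (~~ e) (~~ c) = u ^+ size xs * run_sum u xs x e c.
Proof.
elim: xs x e c => [|x' xs IH] x e c /=; first by rewrite !run_sum_nil mulr1.
case/andP=> nx p; have v2 := uX_unip (size xs); rewrite exprS.
have [lt|lt|/eqP eqx] := ltngtP x x'; last by rewrite eqx in nx.
  rewrite !run_sum_asc // (IH x' false true p) /= negbK.
  by ring: u2 v2.
rewrite !run_sum_desc // (IH x' true e p) (IH x' false e p) /=.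
have -> : (~~ c != ~~ e) = (c != e) by case: c; case: e.
by ring: u2 v2.
Qed.

Lemma dvdp_turn_factor c k : u ^+ k = 1 ->
  1 + 'X %| 'X^(~~ c) + u ^+ k * 'X^c.
Proof. by move=> ->; case: c; rewrite mul1r /= ?expr0 ?expr1 1?addrC ?dvdpp. Qed.

(** The exponent grows only for odd [k]; then [k.+1] is even, [u ^+ k.+1 = 1], and the bracket is
    [1 + 'X]. *)
Lemma dvdp_turn_step c k p : (1 + 'X) ^+ k./2 %| p ->
  (1 + 'X) ^+ k.+1./2 %| ('X^(~~ c) + u ^+ k.+1 * 'X^c) * p.
Proof.
move=> dvp; have -> : k.+1./2 = (odd k + k./2)%N by exact: uphalf_half.
rewrite exprD dvdp_mul //; case: (boolP (odd k)) => ok; last by rewrite dvd1p.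
apply: dvdp_turn_factor; have -> : k.+1 = (k.+1./2 + k.+1./2)%N by lia.
by rewrite exprD uX_unip.
Qed.

Hypothesis u1 : u = 1 \/ u = -1.

(* The second sum is the contribution of a word whose step into [x] is a
   descent: the sign of [x] then only influences the next step. *)
Lemma dvdp_run_sum xs x : neq_path x xs ->
  (forall e, (1 + 'X) ^+ (size xs)./2 %| run_sum u xs x e (~~ e)) /\
  (forall c, (1 + 'X) ^+ (size xs).+1./2 %|
     run_sum u xs x false c + u * run_sum u xs x true c).
Proof.
elim: xs x => [|x' xs IH] x /=.
  by move=> _; split=> *; rewrite expr0 dvd1p.
case/andP=> nx p; have [dvH dvK] := IH x' p; set r := size xs in dvH dvK *.
have v2 := uX_unip r.
have [lt|lt|/eqP eqx] := ltngtP x x'; last by rewrite eqx in nx.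
  have ascE e c : run_sum u (x' :: xs) x e c =
      ('X^(~~ c) + u ^+ r.+1 * 'X^c) * run_sum u xs x' false true.
    rewrite run_sum_asc // exprS (run_sum_neg false true p) -/r.
    by ring: u2 v2.
  split=> [e|c]; rewrite !ascE; first exact: dvdp_turn_step.
  (* Valley at [x]: the summand does not depend on the sign of [x], so the sum over it has the
     factor [1 + u]. For [u = 1] the bracket supplies the additional [1 + 'X]. *)
  case: u1 => eu; last by rewrite eu mulN1r subrr dvdp0.
  have distr (q : {poly int}) : q + u * q = (1 + u) * q by ring.
  rewrite distr dvdp_mull // exprS dvdp_mul //.
  by apply: dvdp_turn_factor; rewrite eu expr1n.
(* The first claim is a peak at [x]: one turn, then the second claim for [x']. *)
split=> [e|c]; rewrite !run_sum_desc //; first by rewrite dvdp_mull.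
(* Double descent: the two signs of [x] give opposite next steps. Flipping all later signs makes the
   two remaining sums proportional, which leaves one bracket of [dvdp_turn_step]. *)
have -> : run_sum u xs x' false true + u * run_sum u xs x' true true =
    u ^+ r.+1 * (run_sum u xs x' false false + u * run_sum u xs x' true false).
  have := run_sum_neg true false p; have := run_sum_neg false false p.
  by rewrite -/r /= => -> ->; rewrite exprS; ring: u2 v2.
have := dvdp_turn_step (~~ c) (dvK false).
rewrite negbK; apply: etrans; congr (_ %| _); rewrite [u ^+ r.+2]exprS.
by case: (c); rewrite /=; ring.
Qed.

End UnipotentWeight.

(** * Alternating runs as turns of a word *)

Lemma turnsE z y ys (L := nth 0 [:: z, y & ys]) : turns (z < y) y ys =
  (\sum_(k < size ys) ((L k < L k.+1)%R != (L k.+1 < L k.+2)%R))%N.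
Proof.
rewrite {}/L; elim: ys z y => [|y' ys IH] z y /=; first by rewrite big_ord0.
by rewrite big_ord_recl /= IH.
Qed.

Lemma letter_neq n (w : signed_perm n) k : (k < n)%N ->
  letter w k != letter w k.+1.
Proof.
move=> ltk; apply/eqP => /(congr1 absz).
rewrite (letterS w (Ordinal ltk)) abs_window.
case: k ltk => [//|k] ltk; rewrite (letterS w (Ordinal (ltnW ltk))) abs_window.
by case=> /val_inj/perm_inj/(congr1 val) /=; lia.
Qed.

Definition alternating_runs (ys : seq int) : nat :=
  if ys is y :: ys' then (turns (0 < y) y ys').+1 else 0%N.

(** Consecutive letters differ, so a turn is either a peak or a valley. *)
Lemma altruns_BE n (w : signed_perm n.+1) :
  altruns_B w = alternating_runs [seq window w j | j : 'I_n.+1].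
Proof.
have letE : letter w =1 nth 0 (0 :: [seq window w j | j : 'I_n.+1]) by [].
have: size [seq window w j | j : 'I_n.+1] = n.+1 by rewrite size_map size_enum_ord.
case: [seq _ | _ in _] letE => // y ys letE [szys] /=.
rewrite turnsE /altruns_B addn1 /pk_B /val_B; congr _.+1.
rewrite -!sum1dep_card big_mkcond [X in (_ + X)%N]big_mkcond -big_split.
(* The index split off is position 0, which [0 < i] excludes. *)
rewrite big_ord_recl /= add0n szys.
apply: eq_bigr => k _; rewrite /bump add1n.
have := letter_neq w (ltnW (ltn_ord k : (k.+1 < n.+1)%N)).
have := letter_neq w (ltn_ord k : (k.+1 < n.+1)%N).
by rewrite /= add0n !letE /=; case: ltgtP => // _; case: ltgtP => //.
Qed.

(** * Sign sums over windows and the parity of [inv_B] *)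

Lemma window_word n (w : signed_perm n) :
  [seq window w j | j : 'I_n] =
  signed_word [seq (w.1 j).+1 | j : 'I_n] [seq j \in w.2 | j : 'I_n].
Proof. by rewrite /signed_word zip_map -map_comp. Qed.

Lemma count_signs n (N : {set 'I_n}) : count id [seq j \in N | j : 'I_n] = #|N|.
Proof. by rewrite count_map cardE enumT size_filter. Qed.

Lemma big_signs (R : nmodType) n (F : seq bool -> R) :
  \sum_(N : {set 'I_n}) F [seq j \in N | j : 'I_n] = \sum_(es : n.-tuple bool) F es.
Proof.
rewrite (reindex (fun N : {set 'I_n} => [tuple j \in N | j < n])).
  by [].
exists (fun es : n.-tuple bool => [set j | tnth es j]) => [N _|es _].
  by apply/setP => j; rewrite inE tnth_mktuple.
by apply: eq_from_tnth => j; rewrite tnth_mktuple inE.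
Qed.

Lemma neq_path_perm n (s : 'S_n.+1) x xs :
  [seq (s j).+1 | j : 'I_n.+1] = x :: xs -> neq_path x xs.
Proof.
move=> e; have: uniq (x :: xs).
  rewrite -e map_inj_uniq ?enum_uniq // => i j [] /val_inj.
  exact: perm_inj.
by rewrite uniq_pairwise => /pairwise_sorted.
Qed.

Lemma dvdp_sign_sum (u : {poly int}) n (s : 'S_n.+1) : u = 1 \/ u = -1 ->
  (1 + 'X) ^+ n./2 %|
  \sum_(N : {set 'I_n.+1})
    u ^+ #|N| * 'X^(altruns_B ((s, N) : signed_perm n.+1)).
Proof.
move=> u1; have u2 : u * u = 1 by case: u1 => ->; rewrite ?mulrNN mulr1.
under eq_bigr do rewrite altruns_BE window_word -count_signs /=.
rewrite (big_signs _ (fun es => u ^+ count id es *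
  'X^(alternating_runs (signed_word [seq (s j).+1 | j : 'I_n.+1] es)))).
have: size [seq (s j).+1 | j : 'I_n.+1] = n.+1 by rewrite size_map size_enum_ord.
case E: [seq _ | _ in _] => [//|x xs] [szxs]; have p := neq_path_perm E.
rewrite (big_tuple_cons _ (fun es => u ^+ count id es *
  'X^(alternating_runs (signed_word (x :: xs) es)))).
apply: (big_ind (dvdp ((1 + 'X) ^+ n./2))) => [|? ?|e _];
  [exact: dvdp0 | exact: dvdp_add | ].
have -> : \sum_(es : n.-tuple bool) u ^+ count id (e :: es) *
   'X^(alternating_runs (signed_word (x :: xs) (e :: es))) =
   u ^+ e * 'X * run_sum u xs x e (~~ e).
  rewrite /run_sum szxs mulr_sumr; apply: eq_bigr => es _ /=.
  (* The step from pi_0 = 0 rises in absolute value, so the first claim of [dvdp_run_sum] is the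
     relevant one. *)
  have -> : (0 < signed_int e x) = ~~ e.
    have : x \in [seq (s j).+1 | j : 'I_n.+1] by rewrite E mem_head.
    by case/mapP => j _ ->; case: (e).
  by rewrite exprD exprS; ring.
by rewrite dvdp_mull // -szxs; case: (dvdp_run_sum u2 u1 p).
Qed.

(** For i < j, exactly one of the two inequalities holds if |pi_i| > |pi_j|; otherwise both or
    neither hold, according to the sign of pi_j. *)
Lemma odd_inv_B n (w : signed_perm n) :
  odd (inv_B w) =
  odd #|[set ij : 'I_n * 'I_n | (ij.1 < ij.2) && (w.1 ij.2 < w.1 ij.1)]%N| (+)
  odd #|w.2|.
Proof.
rewrite /inv_B oddD; congr (_ (+) _); last first.
  congr (odd #|pred_of_set _|); apply/setP => i; rewrite inE /window.
  by case: (i \in w.2).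
rewrite -!sum1dep_card big_mkcond [X in (_ + X)%N]big_mkcond -big_split /=.
rewrite [X in _ = odd X]big_mkcond /= !(big_morph odd oddD erefl).
apply: eq_bigr => -[i j] _ /=; case: ltnP => //= ltij.
have : w.1 i != w.1 j :> nat.
  by rewrite (inj_eq val_inj) (inj_eq perm_inj) -(inj_eq val_inj) neq_ltn ltij.
rewrite /window; case: (i \in w.2); case: (j \in w.2);
  case: (ltngtP (w.1 i) (w.1 j)) => // l _; do 2! (case: ltrP => ?; try lia).
Qed.

Lemma dvdp_signed_total (u : {poly int}) n : u = 1 \/ u = -1 ->
  (1 + 'X) ^+ n./2 %|
  \sum_(w : signed_perm n.+1) u ^+ inv_B w * 'X^(altruns_B w).
Proof.
move=> u1; have uE k : u ^+ k = u ^+ odd k.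
  by case: u1 => ->; rewrite ?expr1n ?signr_odd.
rewrite -(pair_big xpredT xpredT (fun s N =>
  u ^+ inv_B ((s, N) : signed_perm n.+1) * 'X^(altruns_B ((s, N) : signed_perm n.+1)))) /=.
apply: (big_ind (dvdp ((1 + 'X) ^+ n./2))) => [|? ?|s _];
  [exact: dvdp0 | exact: dvdp_add | ].
set f := #|[set ij : 'I_n.+1 * 'I_n.+1 | (ij.1 < ij.2) && (s ij.2 < s ij.1)]%N|.
have -> : \sum_(N : {set 'I_n.+1}) u ^+ inv_B ((s, N) : signed_perm n.+1) *
      'X^(altruns_B ((s, N) : signed_perm n.+1)) = u ^+ f *
    \sum_(N : {set 'I_n.+1})
      u ^+ #|N| * 'X^(altruns_B ((s, N) : signed_perm n.+1)).
  rewrite mulr_sumr; apply: eq_bigr => N _; rewrite mulrA -exprD; congr (_ * _).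
  by rewrite uE odd_inv_B -oddD -uE.
by rewrite dvdp_mull // dvdp_sign_sum.
Qed.

(** Pseudo-divisibility is blind to the factor 2, and for a monic divisor it is divisibility in
    Z[t]. *)
Lemma divides_half m (p : {poly int}) :
  (1 + 'X) ^+ m %| 2%:Z *: p -> divides_in_Zt ((1 + 'X) ^+ m) p.
Proof.
rewrite dvdpZr // => /Pdiv.IdomainMonic.dvdpP => h.
have [|q ->] := h.
  by rewrite monic_exp // addrC -polyC1 monicXaddC.
by exists q; rewrite mulrC.
Qed.

Theorem theorem39 (n : nat) (hn : (0 < n)%N) :
  let m := ((n - 1) %/ 2)%N in
  divides_in_Zt ((1 + 'X) ^+ m) (R_Bplus n) /\
  divides_in_Zt ((1 + 'X) ^+ m) (R_Bminus n).
Proof.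
case: n hn => // n _ m; have {m}-> : m = n./2 by rewrite /m subn1 divn2.
have d1 := @dvdp_signed_total 1 n (or_introl erefl).
have d2 := @dvdp_signed_total (-1) n (or_intror erefl).
split; apply: divides_half.
  suff -> : 2%:Z *: R_Bplus n.+1 =
    \sum_(w : signed_perm n.+1) 1 ^+ inv_B w * 'X^(altruns_B w) +
    \sum_(w : signed_perm n.+1) (-1) ^+ inv_B w * 'X^(altruns_B w).
    exact: dvdp_add.
  rewrite -big_split scaler_sumr big_mkcond /=; apply: eq_bigr => w _.
  rewrite inE expr1n -signr_odd -mul_polyC.
  by case: odd; rewrite /= ?expr0 ?expr1; ring.
suff -> : 2%:Z *: R_Bminus n.+1 =
  \sum_(w : signed_perm n.+1) 1 ^+ inv_B w * 'X^(altruns_B w) -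
  \sum_(w : signed_perm n.+1) (-1) ^+ inv_B w * 'X^(altruns_B w).
  by rewrite dvdp_sub.
rewrite -sumrB scaler_sumr big_mkcond /=; apply: eq_bigr => w _.
rewrite !inE expr1n -signr_odd -mul_polyC.
by case: odd; rewrite /= ?expr0 ?expr1; ring.
Qed.
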